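(* Let $T$ be a Leibniz triple system with product $\langle -,-,-\rangle$, and for $a,b\in T$ define endomorphisms $L_{a,b},R_{a,b}$ of $T$ by $L_{a,b}(x)=\langle a,b,x\rangle$ and $R_{a,b}(x)=\langle x,a,b\rangle-\langle x,b,a\rangle$. Then for all $a,b,c,d,e\in T$: $$R_{a,b}(\langle c,d,e\rangle)=\langle R_{a,b}(c),d,e\rangle+\langle c,R_{a,b}(d),e\rangle+\langle c,d,R_{a,b}(e)\rangle,$$ $$L_{a,b}(\langle c,d,e\rangle)=\langle L_{a,b}(c),d,e\rangle-\langle L_{a,b}(d),c,e\rangle-\langle L_{a,b}(e),c,d\rangle+\langle L_{a,b}(e),d,c\rangle,$$ $$[R_{a,b},R_{c,d}]=R_{R_{a,b}(c),d}-R_{R_{a,b}(d),c},$$ $$[R_{c,d},L_{a,b}]=L_{L_{a,b}(c),d}-L_{L_{a,b}(d),c},$$ where $[f,g]=f\circ g-g\circ f$ is the commutator of endomorphisms. In particular, $R_{a,b}$ is a ternary derivation and $L_{a,b}$ is a Lie triple derivation.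
   Context: A Leibniz triple system is a vector space $T$ (over a field) with a trilinear operation $\langle -,-,-\rangle\colon T\times T\times T\to T$ satisfying, for all $a,b,c,d,e\in T$, $$\langle a,\langle b,c,d\rangle,e\rangle=\langle\langle a,b,c\rangle,d,e\rangle-\langle\langle a,c,b\rangle,d,e\rangle-\langle\langle a,d,b\rangle,c,e\rangle+\langle\langle a,d,c\rangle,b,e\rangle,$$ $$\langle a,b,\langle c,d,e\rangle\rangle=\langle\langle a,b,c\rangle,d,e\rangle-\langle\langle a,b,d\rangle,c,e\rangle-\langle\langle a,b,e\rangle,c,d\rangle+\langle\langle a,b,e\rangle,d,c\rangle.$$ An endomorphism (linear map) $D$ of a triple system $T$ with product $\{-,-,-\}$ is a ternary derivation if $D(\{a,b,c\})=\{D(a),b,c\}+\{a,D(b),c\}+\{a,b,D(c)\}$ for all $a,b,c$, and a Lie triple derivation if $D(\{a,b,c\})=\{D(a),b,c\}-\{D(b),a,c\}-\{D(c),a,b\}+\{D(c),b,a\}$ for all $a,b,c$. *)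

(* Defs.v *)
From HB Require Import structures.
From mathcomp Require Import all_boot all_order all_algebra.

Set Implicit Arguments.
Unset Strict Implicit.
Unset Printing Implicit Defensive.

Import GRing.Theory.
Local Open Scope ring_scope.

(* [lmodType F] over a field: no finite-dimensionality is assumed. *)
HB.mixin Record isTripleSystem (F : fieldType) T of GRing.Lmodule F T := {
  triple : T -> T -> T -> T;
  triple_linear1 : forall b c : T, linear (fun a => triple a b c);
  triple_linear2 : forall a c : T, linear (fun b => triple a b c);
  triple_linear3 : forall a b : T, linear (fun c => triple a b c)
}.

#[short(type="tripleSystemType")]
HB.structure Definition TripleSystem (F : fieldType) :=
  { T of GRing.Lmodule F T & isTripleSystem F T }.

Notation "[< a , b , c >]" := (triple a b c)
  (at level 0, a, b, c at level 99, format "[< a ,  b ,  c >]") : ring_scope.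

HB.mixin Record isLeibnizTriple (F : fieldType) T of TripleSystem F T := {
  leibniz_triple_mid : forall a b c d e : T,
    [< a, [< b, c, d >], e >] =
      [< [< a, b, c >], d, e >] - [< [< a, c, b >], d, e >]
      - [< [< a, d, b >], c, e >] + [< [< a, d, c >], b, e >];
  leibniz_triple_right : forall a b c d e : T,
    [< a, b, [< c, d, e >] >] =
      [< [< a, b, c >], d, e >] - [< [< a, b, d >], c, e >]
      - [< [< a, b, e >], c, d >] + [< [< a, b, e >], d, c >]
}.

#[short(type="leibnizTripleType")]
HB.structure Definition LeibnizTriple (F : fieldType) :=
  { T of TripleSystem F T & isLeibnizTriple F T }.

Section Endomorphisms.
Variables (F : fieldType) (T : tripleSystemType F).
Implicit Types (a b c x : T) (D f g : {linear T -> T}).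

Definition ternary_derivation D : Prop := forall a b c,
  D [< a, b, c >] = [< D a, b, c >] + [< a, D b, c >] + [< a, b, D c >].

Definition lie_triple_derivation D : Prop := forall a b c,
  D [< a, b, c >] =
    [< D a, b, c >] - [< D b, a, c >] - [< D c, a, b >] + [< D c, b, a >].

Definition commutator f g : T -> T := (f \o g) \- (g \o f).

Definition Lop a b x : T := [< a, b, x >].

Definition Rop a b x : T := [< x, a, b >] - [< x, b, a >].

Fact Lop_is_linear a b : linear (Lop a b).
Proof. exact: triple_linear3. Qed.

Fact Rop_is_linear a b : linear (Rop a b).
Proof.
by move=> k x y; rewrite /Rop !triple_linear1 scalerBr opprD addrACA.
Qed.

HB.instance Definition _ a b :=
  GRing.isLinear.Build F T T *:%R (Lop a b) (Lop_is_linear a b).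
HB.instance Definition _ a b :=
  GRing.isLinear.Build F T T *:%R (Rop a b) (Rop_is_linear a b).

End Endomorphisms.

(* Main.v *)
(* Antisymmetrizing the Leibniz identities gives
     <c, R_{a,b} d, e> = E - <R_{a,b} c, d, e>  and
     <c, d, R_{a,b} e> = R_{a,b} <c, d, e> - E
   with the same E = <<c,d,a>,b,e> - <<c,d,b>,a,e>.  Their sum is the derivation
   rule for R, which yields [R, R]; the second one alone yields [R, L]. *)
Require Import Defs.
From HB Require Import structures.
From mathcomp Require Import all_boot all_order all_algebra.

Set Implicit Arguments.
Unset Strict Implicit.
Unset Printing Implicit Defensive.

Import GRing.Theory.
Local Open Scope ring_scope.

(* The left-hand side is the shape of either Leibniz identity after
   antisymmetrizing its inner product in the two arguments of [Rop]. *)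
Lemma sub_swap (V : zmodType) (p q r s p' s' : V) :
  (p - q - r + s) - (p' - r - q + s') = (p - p') - (s' - s).
Proof.
rewrite [p' - r - q]addrAC opprD addrACA (opprB _ r) subrKA.
by rewrite !opprB subrKA.
Qed.

Section LeibnizTriple.
Variables (F : fieldType) (T : leibnizTripleType F).
Implicit Types a b c d e x : T.

Lemma tripleBl a a' b c : [< a - a', b, c >] = [< a, b, c >] - [< a', b, c >].
(* [linear] splits [k *: u + v], so the negated argument becomes a [-1] multiple moved to the
   front. *)
Proof. by rewrite -[- a']scaleN1r addrC triple_linear1 scaleN1r addrC. Qed.

Lemma tripleBm a b b' c : [< a, b - b', c >] = [< a, b, c >] - [< a, b', c >].
Proof. by rewrite -[- b']scaleN1r addrC triple_linear2 scaleN1r addrC. Qed.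

Lemma tripleBr a b c c' : [< a, b, c - c' >] = [< a, b, c >] - [< a, b, c' >].
Proof. by rewrite -[- c']scaleN1r addrC triple_linear3 scaleN1r addrC. Qed.

(** Exchanging [a] and [b] swaps the two negative terms of the Leibniz identity, so only its first
    and last terms survive. *)
Lemma triple_Rop_mid a b c d e :
  [< c, Rop a b d, e >] =
    ([< [< c, d, a >], b, e >] - [< [< c, d, b >], a, e >]) - [< Rop a b c, d, e >].
Proof. by rewrite /Rop tripleBm tripleBl !leibniz_triple_mid sub_swap. Qed.

Lemma triple_Rop_right a b c d e :
  [< c, d, Rop a b e >] =
    Rop a b [< c, d, e >] - ([< [< c, d, a >], b, e >] - [< [< c, d, b >], a, e >]).
Proof. by rewrite /Rop tripleBr !leibniz_triple_right sub_swap. Qed.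

Lemma Rop_derivation a b : ternary_derivation (Rop a b).
Proof.
move=> c d e; rewrite triple_Rop_mid triple_Rop_right.
by rewrite [X in X + _]addrC subrK addrC subrK.
Qed.

Lemma Lop_lie_derivation a b : lie_triple_derivation (Lop a b).
Proof. by move=> c d e; exact: leibniz_triple_right. Qed.

Lemma commutator_Rop a b c d :
  commutator (Rop a b) (Rop c d) =1 Rop (Rop a b c) d \- Rop (Rop a b d) c.
Proof.
move=> x; rewrite /commutator /= [Rop c d x in LHS]/Rop linearB /=.
rewrite !Rop_derivation -[X in X - _ - _]addrA.
(* The two terms with [Rop a b] on [x] combine into [Rop c d (Rop a b x)], which cancels. *)
rewrite -[X in _ - X - _]addrA opprD addrACA [Rop c d _ in LHS]/Rop addrC addrK.
(* The rest pairs up by whether [Rop a b] hits [c] or [d]; the [d] pair comes with the opposite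
   sign. *)
by rewrite [X in _ - X = _]addrC opprD addrACA -[X in _ + X = _]opprB.
Qed.

(** With [x] in third place, [triple_Rop_right] measures how far [Rop c d] and [Lop a b] are from
    commuting; its E is the right-hand side. *)
Lemma commutator_Rop_Lop a b c d :
  commutator (Rop c d) (Lop a b) =1 Lop (Lop a b c) d \- Lop (Lop a b d) c.
Proof. by move=> x; rewrite /commutator /= /Lop triple_Rop_right subKr. Qed.

End LeibnizTriple.

Theorem corollary13 (F : fieldType) (T : leibnizTripleType F) :
  (forall a b c d e : T,
    [/\ Rop a b [< c, d, e >] =
          [< Rop a b c, d, e >] + [< c, Rop a b d, e >] + [< c, d, Rop a b e >],
        Lop a b [< c, d, e >] =
          [< Lop a b c, d, e >] - [< Lop a b d, c, e >]
          - [< Lop a b e, c, d >] + [< Lop a b e, d, c >],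
        commutator (Rop a b) (Rop c d) =1
          Rop (Rop a b c) d \- Rop (Rop a b d) c
      & commutator (Rop c d) (Lop a b) =1
          Lop (Lop a b c) d \- Lop (Lop a b d) c]) /\
  (forall a b : T,
    ternary_derivation (Rop a b) /\ lie_triple_derivation (Lop a b)).
Proof.
split=> [a b c d e|a b]; last first.
  by split; [exact: Rop_derivation | exact: Lop_lie_derivation].
split; first exact: Rop_derivation.
- exact: Lop_lie_derivation.
- exact: commutator_Rop.
- exact: commutator_Rop_Lop.
Qed.
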